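(* In the setting below, assume each $f_i$ is $L_i$-smooth, and use the constant stepsize $\eta_k=\eta$ for all $k\in[K]$ with $0<\eta\le\frac{1}{4n\sqrt{2\bar L L^*(1+\log K)}}$. Then there is an absolute constant $C>0$ such that: (i) For arbitrary (possibly adversarial) permutations $\sigma_k$, $$F(x_{K+1})-F_*\le C\left(\frac{D^2}{n\eta K}+(n\eta)^2\bar L\sigma_{\mathrm{any}}^2(1+\log K)\right).$$ In particular, if $D>0$, $\sigma^2_{\mathrm{any}}>0$ and $\eta=\frac{1}{4n\sqrt{2\bar LL^*(1+\log K)}}\wedge\frac{D^{2/3}}{n\sqrt[3]{\bar L\sigma^2_{\mathrm{any}}K(1+\log K)}}$, then $$F(x_{K+1})-F_*\le C\left(\frac{D^2\sqrt{\bar LL^*(1+\log K)}}{K}+\frac{D^{4/3}\sqrt[3]{\bar L\sigma_{\mathrm{any}}^2(1+\log K)}}{K^{2/3}}\right).$$ (ii) If each $\sigma_k$ is a uniformly random permutation (see context), then $$\mathbb E[F(x_{K+1})-F_*]\le C\left(\frac{D^2}{n\eta K}+n\eta^2\bar L\sigma_{\mathrm{rand}}^2(1+\log K)\right).$$ In particular, if $D>0$, $\sigma^2_{\mathrm{rand}}>0$ and $\eta=\frac{1}{4n\sqrt{2\bar LL^*(1+\log K)}}\wedge\frac{D^{2/3}}{\sqrt[3]{n^2\bar L\sigma^2_{\mathrm{rand}}K(1+\log K)}}$, then $$\mathbb E[F(x_{K+1})-F_*]\le C\left(\frac{D^2\sqrt{\bar LL^*(1+\log K)}}{K}+\frac{D^{4/3}\sqrt[3]{\bar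 L\sigma_{\mathrm{rand}}^2(1+\log K)}}{n^{1/3}K^{2/3}}\right).$$
   Context: Setting. Let $n,d\in\mathbb N$, let $f_1,\dots,f_n:\mathbb R^d\to\mathbb R$ be convex, $f=\frac1n\sum_{i=1}^nf_i$, let $\psi:\mathbb R^d\to\mathbb R\cup\{+\infty\}$ be proper, closed and convex, and $F=f+\psi$. For a convex function $g$, $\nabla g(x)$ denotes an element of $\partial g(x)$ (for each $f_i$ a fixed selection of subgradients, the same one used in the algorithm; for differentiable $g$ it is the gradient), and $B_g(x,y)=g(x)-g(y)-\langle\nabla g(y),x-y\rangle$. Assume there is $x_*\in\mathbb R^d$ with $F(x_* )=\inf_{x}F(x)\in\mathbb R$; write $F_*=F(x_* )$. Proximal shuffling gradient method: given $x_1\in\mathrm{dom}\,\psi$, a number of epochs $K\ge2$ and stepsizes $\eta_k>0$, for $k=1,\dots,K$: choose a permutation $\sigma_k=(\sigma_k^1,\dots,\sigma_k^n)$ of $[n]=\{1,\dots,n\}$; set $x_k^1=x_k$ and $x_k^{i+1}=x_k^i-\eta_k\nabla f_{\sigma_k^i}(x_k^i)$ for $i=1,\dots,n$; set $x_{k+1}=\arg\min_{x\in\mathbb R^d}\{n\psi(x)+\frac{1}{2\eta_k}\|x-x_k^{n+1}\|^2\}$. $D=\|x_*-x_1\|$; $\|\cdot\|$ is the Euclidean norm; $\log$ is natural; $a\vee b=\max\{a,b\}$, $a\wedge b=\min\{a,b\}$. Smoothness: each $f_i$ is differentiable with $\|\nabla f_i(x)-\nabla f_i(y)\|\le L_i\|x-y\|$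 for all $x,y$, $L_i>0$; $\bar L=\frac1n\sum_iL_i$, $L^*=\max_iL_i$; $\sigma^2_{\mathrm{any}}=\frac1n\sum_{i=1}^n\|\nabla f_i(x_* )\|^2$, $\sigma^2_{\mathrm{rand}}=\sigma^2_{\mathrm{any}}+n\|\nabla f(x_* )\|^2$. Uniformly random permutation: each $\sigma_k$ is uniformly distributed over all permutations of $[n]$ (the joint dependence between different epochs is arbitrary, e.g. resampled every epoch or sampled once and reused); expectations are over the permutations. *)

(* Defs.v *)
From HB Require Import structures.
From mathcomp Require Import all_boot all_order all_algebra all_fingroup.
From mathcomp Require Import all_classical all_reals all_analysis.
Set Implicit Arguments. Unset Strict Implicit. Unset Printing Implicit Defensive.
Import Order.TTheory GRing.Theory Num.Theory.
Local Open Scope ring_scope.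

Section PSG.
Variables (R : realType) (d : nat).
Notation V := 'rV[R]_d.

Definition dotv (u v : V) : R := \sum_(i < d) u 0 i * v 0 i.
Definition enorm (u : V) : R := Num.sqrt (dotv u u).

Definition convex_fun (f : V -> R) : Prop :=
  forall (x y : V) (t : R), 0 <= t <= 1 ->
    f (t *: x + (1 - t) *: y) <= t * f x + (1 - t) * f y.

Definition is_gradient (f : V -> R) (gx x : V) : Prop :=
  forall e : R, 0 < e -> exists2 delta : R, 0 < delta &
    forall y : V, enorm (y - x) < delta ->
      `|f y - f x - dotv gx (y - x)| <= e * enorm (y - x).

Definition proper_fun (psi : V -> \bar R) : Prop :=
  (forall x, psi x != -oo%E) /\ (exists x, psi x \is a fin_num).
Definition closed_fun (psi : V -> \bar R) : Prop :=
  forall (x : V) (a : R), (a%:E < psi x)%E ->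
    exists2 delta : R, 0 < delta &
      forall y : V, enorm (y - x) < delta -> (a%:E < psi y)%E.
Definition convex_efun (psi : V -> \bar R) : Prop :=
  forall (x y : V) (t : R), 0 <= t <= 1 ->
    (psi (t *: x + (1 - t) *: y)%R <= t%:E * psi x + (1 - t)%R%:E * psi y)%E.

Variable n : nat.

Definition favg (fs : 'I_n -> V -> R) (x : V) : R := n%:R^-1 * \sum_(i < n) fs i x.
Definition Fobj (fs : 'I_n -> V -> R) (psi : V -> \bar R) (x : V) : \bar R :=
  ((favg fs x)%:E + psi x)%E.

Definition inner_pass (g : 'I_n -> V -> V) (eta : R) (s : 'S_n) (x : V) : V :=
  foldl (fun y j => y - eta *: g j y) x [seq s j | j <- enum 'I_n].

Definition prox_obj (psi : V -> \bar R) (eta : R) (z x : V) : \bar R :=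
  ((n%:R)%:E * psi x + ((2 * eta)^-1 * enorm (x - z) ^+ 2)%:E)%E.

Definition is_argmin (h : V -> \bar R) (x : V) : Prop :=
  forall y : V, (h x <= h y)%E.

(* x is a run of the proximal shuffling gradient method with constant stepsize
   eta, starting point x1, K epochs and permutations sigma (epoch k+1 of the
   paper uses sigma k, k : 'I_K); iterates x 1, ..., x (K+1). *)
Definition prox_shuffling_run (g : 'I_n -> V -> V) (psi : V -> \bar R)
    (eta : R) (x1 : V) (K : nat) (sigma : 'I_K -> 'S_n) (x : nat -> V) : Prop :=
  x 1%N = x1 /\
  forall k : 'I_K,
    is_argmin (prox_obj psi eta (inner_pass g eta (sigma k) (x k.+1))) (x k.+2).

Definition Lbar (L : 'I_n -> R) : R := n%:R^-1 * \sum_(i < n) L i.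
Definition Lstar (L : 'I_n -> R) : R := \big[Num.max/0]_(i < n) L i.
Definition sigma2_any (g : 'I_n -> V -> V) (xs : V) : R :=
  n%:R^-1 * \sum_(i < n) enorm (g i xs) ^+ 2.
Definition gradf (g : 'I_n -> V -> V) (x : V) : V := n%:R^-1 *: \sum_(i < n) g i x.
Definition sigma2_rand (g : 'I_n -> V -> V) (xs : V) : R :=
  sigma2_any g xs + n%:R * enorm (gradf g xs) ^+ 2.

Definition uniform_marginals (K : nat) (P : {ffun 'I_K -> 'S_n} -> R) : Prop :=
  (forall w, 0 <= P w) /\ (\sum_w P w = 1) /\
  forall (k : 'I_K) (s : 'S_n), \sum_(w : {ffun 'I_K -> 'S_n} | w k == s) P w = (n`!)%:R^-1.

End PSG.

(* Main.v *)
Require Import Defs.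
From HB Require Import structures.
From mathcomp Require Import all_boot all_order all_algebra all_fingroup.
From mathcomp Require Import all_classical all_reals all_analysis.
From mathcomp Require Import ring lra zify.
Set Implicit Arguments. Unset Strict Implicit. Unset Printing Implicit Defensive.
Import Order.TTheory GRing.Theory Num.Theory.
Local Open Scope ring_scope.

(** One epoch from [x] to [x'] satisfies, for every [z] in the domain of [psi],
    [F x' - F z <= (|z - x|^2 - |z - x'|^2) / (2 n eta) + alpha (F z - F xs) + r],
    with [alpha] of order [(n eta Lbar)^2] and [r] depending only on the
    permutation of the epoch: by cocoercivity the gradients along the inner pass
    differ from those at [z] by Bregman terms, which the linearisation error
    absorbs, and those at [z] differ from those at [xs] by a Bregman term bounded
    by [F z - F xs].  Taking [z = xs] bounds the average of the gaps; taking [z]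
    to be an earlier iterate compares the averages over the last [l] and the last
    [l + 1] iterates, at the price of a factor [1 - alpha / (l + 1)].  Since
    [alpha (1 + ln K) <= 3/4], the product of these factors stays above [1/4].
    The bound is linear in the [r]'s with deterministic coefficients of total mass
    at most [1 + ln K], so only the mean of [r] under a single uniform permutation
    matters and the joint law of the epochs plays no role. *)

(** * Euclidean geometry and smooth convex functions *)

Section EuclideanSpace.
Variables (R : realType) (d : nat).
Implicit Types u v w : 'rV[R]_d.

Lemma dotvC u v : dotv u v = dotv v u.
Proof. by apply: eq_bigr => i _; rewrite mulrC. Qed.

Lemma dotvDl u v w : dotv (u + v) w = dotv u w + dotv v w.
Proof. by rewrite -big_split; apply: eq_bigr => i _; rewrite /= mxE mulrDl. Qed.

Lemma dotvZl a u v : dotv (a *: u) v = a * dotv u v.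
Proof. by rewrite mulr_sumr; apply: eq_bigr => i _; rewrite mxE mulrA. Qed.

Lemma dotvNl u v : dotv (- u) v = - dotv u v.
Proof. by rewrite -scaleN1r dotvZl mulN1r. Qed.

Lemma dotvDr u v w : dotv w (u + v) = dotv w u + dotv w v.
Proof. by rewrite dotvC dotvDl !(dotvC w). Qed.

Lemma dotvZr a u v : dotv v (a *: u) = a * dotv v u.
Proof. by rewrite dotvC dotvZl dotvC. Qed.

Lemma dotvNr u v : dotv v (- u) = - dotv v u.
Proof. by rewrite dotvC dotvNl dotvC. Qed.

Lemma dotv_suml (I : Type) (r : seq I) (P : pred I) (F : I -> 'rV[R]_d) v :
  dotv (\sum_(i <- r | P i) F i) v = \sum_(i <- r | P i) dotv (F i) v.
Proof.
elim/big_rec2: _ => [|i x y _ <-]; last by rewrite dotvDl.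
by rewrite -(scale0r v) dotvZl mul0r.
Qed.

Lemma dotv_sumr (I : Type) (r : seq I) (P : pred I) (F : I -> 'rV[R]_d) v :
  dotv v (\sum_(i <- r | P i) F i) = \sum_(i <- r | P i) dotv v (F i).
Proof. by rewrite dotvC dotv_suml; apply: eq_bigr => i _; rewrite dotvC. Qed.

Definition dotvE := (dotvDl, dotvDr, dotvNl, dotvNr, dotvZl, dotvZr).

Lemma dotv_ge0 u : 0 <= dotv u u.
Proof. by apply: sumr_ge0 => i _; rewrite -expr2 sqr_ge0. Qed.

Lemma enorm_ge0 u : 0 <= enorm u.
Proof. exact: sqrtr_ge0. Qed.

Lemma sqr_enorm u : enorm u ^+ 2 = dotv u u.
Proof. by rewrite sqr_sqrtr ?dotv_ge0. Qed.

Lemma enormZ a u : 0 <= a -> enorm (a *: u) = a * enorm u.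
Proof.
move=> a0; rewrite /enorm dotvZl dotvZr mulrA -expr2 sqrtrM ?sqr_ge0//.
by rewrite sqrtr_sqr ger0_norm.
Qed.

Lemma dotv_sub_sym u v : dotv (u - v) (u - v) = dotv (v - u) (v - u).
Proof. by rewrite -opprB dotvNl dotvNr opprK. Qed.

Lemma dotvD_le2 u v :
  dotv (u + v) (u + v) <= 2 * dotv u u + 2 * dotv v v.
Proof.
have := dotv_ge0 (u - v); rewrite !dotvE (dotvC v u); lra.
Qed.

Lemma dotvD_le3 u v w : dotv (u + v + w) (u + v + w) <=
  3 * (dotv u u + dotv v v + dotv w w).
Proof.
have := dotv_ge0 (u - v); have := dotv_ge0 (u - w); have := dotv_ge0 (v - w).
rewrite !dotvE (dotvC v u) (dotvC w u) (dotvC w v); lra.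
Qed.

(* Expand the sum over [P j] of [l j * |a j / l j - S / Lam|^2], where [S] is
   the sum of the [a j] and [Lam] the sum of all [l j]. *)
Lemma dotv_sum_le (I : finType) (P : pred I) (a : I -> 'rV[R]_d) (l b : I -> R) :
  (forall i, 0 < l i) -> (forall i, 0 <= b i) ->
  (forall i, dotv (a i) (a i) <= l i * b i) ->
  dotv (\sum_(i | P i) a i) (\sum_(i | P i) a i) <= (\sum_i l i) * (\sum_i b i).
Proof.
move=> l0 b0 ab; set S := \sum_(i | P i) a i; set Lam := \sum_i l i.
have Lam0 : 0 <= Lam by apply: sumr_ge0 => i _; exact: ltW.
have B0 : 0 <= \sum_i b i by apply: sumr_ge0.
have key : 0 <= \sum_(i | P i)
    (Lam ^+ 2 * b i - 2 * Lam * dotv (a i) S + l i * dotv S S).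
  apply: sumr_ge0 => i _; have li := l0 i.
  rewrite -(pmulr_rge0 _ li).
  have := dotv_ge0 (Lam *: a i - l i *: S).
  rewrite !dotvE (dotvC S) => H.
  have := ler_wpM2l (sqr_ge0 Lam) (ab i); nra.
move: key; rewrite big_split /= sumrB -!mulr_sumr -mulr_suml -dotv_suml -/S.
have le1 : \sum_(i | P i) b i <= \sum_i b i.
  by rewrite big_mkcond /=; apply: ler_sum => i _; case: ifP.
have le2 : \sum_(i | P i) l i <= Lam.
  by rewrite big_mkcond /=; apply: ler_sum => i _; case: ifP => // _; exact: ltW.
have S0 := dotv_ge0 S.
have := ler_wpM2r S0 le2; have := ler_wpM2l (sqr_ge0 Lam) le1 => h1 h2 h3.
move: Lam0; rewrite le_eqVlt => /predU1P[Lz|Lpos]; last first.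
  rewrite -(ler_pM2l Lpos); nra.
have Pz : forall i, ~~ P i.
  move=> i; apply/negP => _; have := l0 i; rewrite ltNge.
  rewrite Lz /Lam (bigD1 i)//= lerDl sumr_ge0// => j _; exact: ltW.
rewrite -Lz mul0r /S big1 => [|i Pi]; last by move: (Pz i); rewrite Pi.
by rewrite -(scale0r 0) dotvZl mul0r.
Qed.

End EuclideanSpace.

(** If [a < 0], the hypothesis at [t = 1] forces [b > 0], and at [t = - a / (2 b - a)] the
    expression has the sign of [a (b - a) < 0]. It stands in for the limit [t -> 0] in the
    first-order arguments below. *)
Lemma ge0_of_small_slope (R : realType) (a b : R) :
  (forall t, 0 < t <= 1 -> 0 <= a + t * b) -> 0 <= a.
Proof.
move=> H; rewrite leNgt; apply/negP => a0.
have b0 : 0 < b by have := H 1; rewrite ltr01 lexx => /(_ isT); lra.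
have c0 : 0 < 2 * b - a by lra.
have := H (- a / (2 * b - a)).
rewrite divr_gt0 ?oppr_gt0 //= ler_pdivrMr // mul1r.
have -> : - a <= 2 * b - a by lra.
move/(_ isT); rewrite -(pmulr_rge0 _ c0).
have -> : (2 * b - a) * (a + - a / (2 * b - a) * b) = a * (b - a).
  by field; rewrite gt_eqF.
by rewrite nmulr_rge0 //; lra.
Qed.

Section SmoothConvex.
Variables (R : realType) (d : nat).
Variables (f : 'rV[R]_d -> R) (gr : 'rV[R]_d -> 'rV[R]_d) (L : R).
Hypotheses (f_convex : convex_fun f) (f_grad : forall x, is_gradient f (gr x) x).
Implicit Types x y : 'rV[R]_d.

Definition bregman x y : R := f x - f y - dotv (gr y) (x - y).

Lemma bregman_ge0 x y : 0 <= bregman x y.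
Proof.
set h := x - y; set N := enorm h.
apply: (@ge0_of_small_slope _ _ N) => e /andP[e0 _].
have [delta delta0 H] := f_grad y e0.
have N0 : 0 <= N := enorm_ge0 h.
(* A step that lies in [(0, 1]] and keeps [t * N] below [delta], including when [N = 0]. *)
pose t := delta / (2 * (delta + N)).
have dN : 0 < 2 * (delta + N) by lra.
have t0 : 0 < t by rewrite divr_gt0.
have t1 : t <= 1 by rewrite /t ler_pdivrMr //; lra.
have tN : t * N < delta.
  rewrite /t mulrAC ltr_pdivrMr //; nra.
have yE : t *: x + (1 - t) *: y = y + t *: h.
  by rewrite /h scalerBr scalerBl scale1r addrCA addrC -!addrA (addrC (- _)).
have := f_convex x y (t := t); rewrite (ltW t0) t1 => /(_ isT); rewrite yE.
have := H (y + t *: h); rewrite (addrC y) addrK enormZ ?(ltW t0) // -/N.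
move/(_ tN); rewrite dotvZr ler_norml => /andP[h1 _] h2.
rewrite -(pmulr_rge0 _ t0) /bregman -/h; nra.
Qed.

Hypotheses (L0 : 0 < L)
  (f_lip : forall x y, enorm (gr x - gr y) <= L * enorm (x - y)).

Lemma dotv_grad_lipschitz x y :
  dotv (gr x - gr y) (gr x - gr y) <= L ^+ 2 * dotv (x - y) (x - y).
Proof.
by rewrite -!sqr_enorm -exprMn lerXn2r ?nnegrE ?mulr_ge0 ?enorm_ge0 ?(ltW L0).
Qed.

(** The divergences of [(x, y)] and [(y, x)] add up to [<gr x - gr y, x - y>], which the Lipschitz
    bound controls. Dropping the second one avoids integrating the gradient and costs a factor 2
    against the sharp [L / 2]. *)
Lemma bregman_le x y : bregman x y <= L * dotv (x - y) (x - y).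
Proof.
have h1 := bregman_ge0 y x.
have : bregman x y + bregman y x = dotv (gr x - gr y) (x - y).
  by rewrite /bregman -(opprB x y) dotvDl !dotvNr dotvNl; ring.
move: (dotv_grad_lipschitz x y); move: (gr x - gr y) (x - y) => G h h2 h3.
have := dotv_ge0 (G - L *: h); rewrite !dotvE (dotvC h G) => h4.
have h5 := mulr_ge0 (ltW L0) h1.
have -> : bregman x y = dotv G h - bregman y x by rewrite -h3 addrK.
rewrite -(ler_pM2l L0); lra.
Qed.

(* Minimality of [y] for [f - <gr y, .>], tested at a gradient step of length
   [1 / (2 L)] from [x]. *)
Lemma cocoercive x y :
  dotv (gr x - gr y) (gr x - gr y) <= 4 * L * bregman x y.
Proof.
have [G GE] : exists G, G = gr x - gr y by exists (gr x - gr y).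
rewrite -GE; set t := (2 * L)^-1.
have tL : t * (2 * L) = 1 by rewrite mulVf // gt_eqF // mulr_gt0.
have := bregman_ge0 (x - t *: G) y; have := bregman_le (x - t *: G) x.
rewrite /bregman.
have -> : x - t *: G - x = - (t *: G) by rewrite addrAC subrr add0r.
have -> : x - t *: G - y = (x - y) - t *: G by rewrite addrAC.
rewrite !dotvE => h1 h2.
have GG : dotv G G = dotv (gr x) G - dotv (gr y) G by rewrite {1}GE dotvDl dotvNl.
have t0 : 0 < t by rewrite invr_gt0 mulr_gt0.
rewrite -(ler_pM2l t0).
have := dotv_ge0 G; set q := dotv G G in GG h1 h2 * => q0.
have e1 : L * - - (t * (t * q)) = t * q / 2.
  have -> : L * - - (t * (t * q)) = (t * (2 * L)) * (t * q / 2) by field.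
  by rewrite tL mul1r.
have -> : forall B, t * (4 * L * B) = 2 * B.
  by move=> B; rewrite -[RHS]mul1r -tL; ring.
have tq : t * q = t * dotv (gr x) G - t * dotv (gr y) G by rewrite GG mulrBr.
by rewrite e1 in h1; lra.
Qed.

End SmoothConvex.

(** * One epoch *)

(** Unrolls the fold: [y i] is the point at which the [i]-th gradient of the pass is taken, before
    its step, hence the strict [j < i]. *)
Lemma inner_pass_iterates (R : realType) (d n : nat)
    (g : 'I_n -> 'rV[R]_d -> 'rV[R]_d) (eta : R) (s : 'S_n) (x : 'rV[R]_d) :
  exists y : 'I_n -> 'rV[R]_d,
    (forall i, y i = x - eta *: \sum_(j : 'I_n | (j < i)%N) g (s j) (y j)) /\
    inner_pass g eta s x = x - eta *: \sum_j g (s j) (y j).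
Proof.
pose l := [seq s j | j <- enum 'I_n].
have sl : size l = n by rewrite size_map size_enum_ord.
pose u m := foldl (fun y j => y - eta *: g j y) x (take m l).
have uS (j : 'I_n) : u j.+1 = u j - eta *: g (s j) (u j).
  have jl : (j < size l)%N by rewrite sl.
  rewrite /u (take_nth (s j) jl) foldl_rcons (nth_map j) ?size_enum_ord//.
  by rewrite nth_ord_enum.
have uE m : (m <= n)%N -> u m = x - eta *: \sum_(j : 'I_n | (j < m)%N) g (s j) (u j).
  elim: m => [_|m IH mn].
    by rewrite big_pred0 ?scaler0 ?subr0 // /u take0.
  pose j0 := Ordinal mn.
  rewrite (uS j0) (bigD1 j0) //= {1}[u m]IH ?(ltnW mn)//.
  rewrite -addrA -opprD -scalerDr; congr (_ - _ *: _).
  rewrite addrC; congr (_ + _); apply: eq_bigl => j.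
  by rewrite ltnS -val_eqE /= ltn_neqAle andbC.
exists u; split => [i|]; first by rewrite -uE // ltnW.
rewrite /inner_pass -/l -[l]take_size sl -/(u n) uE //.
by congr (_ - _ *: _); apply: eq_bigl => j; rewrite ltn_ord.
Qed.

Section Epoch.
Variables (R : realType) (n d : nat) (fs : 'I_n -> 'rV[R]_d -> R).
Variables (g : 'I_n -> 'rV[R]_d -> 'rV[R]_d) (L : 'I_n -> R).
Variables (psi : 'rV[R]_d -> \bar R) (xs : 'rV[R]_d) (eta : R).
Hypotheses (n0 : (0 < n)%N) (eta0 : 0 < eta).
Hypothesis fs_convex : forall i, convex_fun (fs i).
Hypothesis fs_grad : forall i x, is_gradient (fs i) (g i x) x.
Hypothesis L0 : forall i, 0 < L i.
Hypothesis g_lip : forall i x y, enorm (g i x - g i y) <= L i * enorm (x - y).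
Hypothesis psi_proper : proper_fun psi.
Hypothesis psi_convex : convex_efun psi.
Hypothesis xs_dom : psi xs \is a fin_num.
Hypothesis xs_min : forall x, (Fobj fs psi xs <= Fobj fs psi x)%E.
Implicit Types x y z : 'rV[R]_d.

Local Notation B i := (bregman (fs i) (g i)).

Lemma sum_Lbar : \sum_i L i = n%:R * Lbar L.
Proof. by rewrite mulrA mulfV ?mul1r // pnatr_eq0 -lt0n. Qed.

Lemma Lbar_gt0 : 0 < Lbar L.
Proof.
rewrite mulr_gt0 ?invr_gt0 ?ltr0n // (bigD1 (Ordinal n0)) //=.
by rewrite ltr_pwDl ?sumr_ge0 // => i _; exact: ltW.
Qed.

(** Properness excludes [-oo] and convexity excludes [+oo], so optimality can be tested along
    segments in real arithmetic. *)
Lemma fin_num_convex_comb x z (t : R) : psi x \is a fin_num ->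
  psi z \is a fin_num -> 0 <= t <= 1 ->
  psi (x + t *: (z - x)) \is a fin_num /\
  fine (psi (x + t *: (z - x))) <= t * fine (psi z) + (1 - t) * fine (psi x).
Proof.
move=> hx hz t01; have := psi_convex z x t01.
have -> : t *: z + (1 - t) *: x = x + t *: (z - x).
  by rewrite scalerBl scalerBr scale1r addrCA.
have := psi_proper.1 (x + t *: (z - x)).
rewrite -(fineK hx) -(fineK hz) -!EFinM -EFinD.
by case: (psi _) => [r||] //=; rewrite lee_fin.
Qed.

(* [xs] minimises the sum of [psi] and the linearisation of [f] at [xs]. *)
Lemma bregman_opt_le z : psi z \is a fin_num ->
  \sum_i B i z xs <=
    n%:R * (favg fs z + fine (psi z) - (favg fs xs + fine (psi xs))).
Proof.
move=> hz; set h := z - xs.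
pose G := \sum_i g i xs.
have nR : n%:R != 0 :> R by rewrite pnatr_eq0 -lt0n.
have favgE x : n%:R * favg fs x = \sum_i fs i x by rewrite mulrA mulfV ?mul1r.
have sumB x : \sum_i B i x xs = \sum_i fs i x - \sum_i fs i xs - dotv G (x - xs).
  by rewrite /bregman !sumrB dotv_suml.
suff : 0 <= n%:R * (fine (psi z) - fine (psi xs)) + dotv G h.
  rewrite sumB -!favgE; lra.
(* Along the segment the smooth part leaves its linearisation by at most [t^2 n Lbar |h|^2];
   dividing by [t] gives this slope. *)
apply: (@ge0_of_small_slope _ _ (n%:R * Lbar L * dotv h h)) => t /andP[t0 t1].
have t01 : 0 <= t <= 1 by rewrite (ltW t0) t1.
have [fin le] := fin_num_convex_comb xs_dom hz t01.
have := xs_min (xs + t *: (z - xs)); rewrite /Fobj -(fineK xs_dom) -(fineK fin).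
rewrite -!EFinD lee_fin => opt.
have : \sum_i B i (xs + t *: h) xs <= \sum_i L i * (t ^+ 2 * dotv h h).
  apply: ler_sum => i _; have := bregman_le (fs_convex i) (fs_grad i) (L0 i) (g_lip i).
  move=> /(_ (xs + t *: h) xs).
  by rewrite (addrC xs) addrK dotvZl dotvZr (mulrA t) -expr2 addrC.
rewrite -mulr_suml sum_Lbar sumB (addrC xs) addrK dotvZr -!favgE.
rewrite [_ + xs]addrC -/h in opt le *.
rewrite -(pmulr_rge0 _ t0).
have npos : 0 < n%:R :> R by rewrite ltr0n.
have {}opt := ler_wpM2l (ltW npos) opt; have {}le := ler_wpM2l (ltW npos) le.
move=> /= le2; lra.
Qed.

(** The prox objective is finite at [xs], hence at the minimiser; [n > 0] keeps [n * +oo]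
    infinite. *)
Lemma prox_fin_num w x : is_argmin (prox_obj n psi eta w) x ->
  psi x \is a fin_num.
Proof.
move=> /(_ xs); rewrite /prox_obj -(fineK xs_dom) -EFinM -EFinD.
have := psi_proper.1 x; case: (psi x) => [r||] //= _.
by rewrite gt0_muley ?lte_fin ?ltr0n // addye // leye_eq.
Qed.

(** Testing minimality of [x] along the segment towards [z] bounds the decrease of [psi] by
    [2 <x - w, z - x>], which is exactly the right-hand side. *)
Lemma prox_three_point w x z : is_argmin (prox_obj n psi eta w) x ->
  psi z \is a fin_num ->
  2 * eta * n%:R * (fine (psi x) - fine (psi z)) <=
    dotv (z - w) (z - w) - dotv (x - w) (x - w) - dotv (z - x) (z - x).
Proof.
move=> argx hz; have hx := prox_fin_num argx.
have -> : z - w = (x - w) + (z - x) by rewrite [RHS]addrC addrA subrK.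
have [a aE] : exists a, a = x - w by exists (x - w).
have [h hE] : exists h, h = z - x by exists (z - x).
rewrite -aE -hE [dotv (a + h) _]dotvDl !dotvDr (dotvC h a) -subr_ge0.
suff : 0 <= 2 * dotv a h - 2 * eta * n%:R * (fine (psi x) - fine (psi z)) by lra.
apply: (@ge0_of_small_slope _ _ (dotv h h)) => t /andP[t0 t1].
have t01 : 0 <= t <= 1 by rewrite (ltW t0) t1.
have [fin le] := fin_num_convex_comb hx hz t01.
have := argx (x + t *: (z - x)); rewrite /prox_obj -(fineK hx) -(fineK fin).
rewrite -!EFinM -!EFinD lee_fin !sqr_enorm.
have -> : x + t *: (z - x) - w = a + t *: h by rewrite addrAC -aE -hE.
rewrite -aE [dotv (a + _) _]dotvDl !dotvDr !dotvZl !dotvZr (dotvC h a).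
rewrite -hE in le *.
have e0 : 0 < 2 * eta by rewrite mulr_gt0.
rewrite -(ler_pM2l e0) !mulrDr !mulVKf ?gt_eqF // => H.
have npos : 0 < 2 * eta * n%:R by rewrite mulr_gt0 ?ltr0n.
have {}le := ler_wpM2l (ltW npos) le.
rewrite -(pmulr_rge0 _ t0) /=; lra.
Qed.

Lemma sum_perm (F : 'I_n -> R) (s : 'S_n) : \sum_i F (s i) = \sum_i F i.
Proof. by rewrite [RHS](reindex_perm s). Qed.

(** The only trace of the permutation in the epoch bound: the drift that gradients frozen at [xs]
    would cause before step [i], weighted by the smoothness constant of the component used at that
    step. *)
Definition prefix_noise (s : 'S_n) : R := \sum_(i < n) L (s i) *
  dotv (\sum_(j < n | (j < i)%N) g (s j) xs) (\sum_(j < n | (j < i)%N) g (s j) xs).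

(** Each gradient splits as [(g (y j) - g z) + (g z - g xs) + g xs]. Cocoercivity and [dotv_sum_le]
    turn the prefix sums of the first two into Bregman sums over the whole epoch; the third is kept
    as noise. *)
Lemma inner_drift (s : 'S_n) x z (y : 'I_n -> 'rV[R]_d) :
  (forall i, y i = x - eta *: \sum_(j : 'I_n | (j < i)%N) g (s j) (y j)) ->
  forall i, dotv (y i - x) (y i - x) <= 3 * eta ^+ 2 *
    (n%:R * Lbar L * (4 * \sum_j B (s j) z (y j))
     + n%:R * Lbar L * (4 * \sum_j B j z xs)
     + dotv (\sum_(j < n | (j < i)%N) g (s j) xs)
            (\sum_(j < n | (j < i)%N) g (s j) xs)).
Proof.
move=> yE i.
pose a := \sum_(j < n | (j < i)%N) (g (s j) (y j) - g (s j) z).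
pose b := \sum_(j < n | (j < i)%N) (g (s j) z - g (s j) xs).
set c := \sum_(j < n | (j < i)%N) g (s j) xs.
have -> : y i - x = (- eta) *: (a + b + c).
  rewrite yE addrAC subrr add0r scaleNr -!big_split /=.
  by congr (- (_ *: _)); apply: eq_bigr => j _; rewrite addrA !subrK.
rewrite dotvZl dotvZr mulrA mulrNN -expr2 -mulrA mulrCA.
apply: ler_wpM2l; first exact: sqr_ge0.
apply: le_trans (dotvD_le3 _ _ _) _; apply: ler_wpM2l; first by [].
have co k u v := cocoercive (fs_convex k) (fs_grad k) (L0 k) (g_lip k) u v.
have B0 k u v := bregman_ge0 (fs_convex k) (fs_grad k) u v.
rewrite lerD2r -sum_Lbar ![4 * _]mulr_sumr -(sum_perm L s); apply: lerD.
  apply: dotv_sum_le => [//|j|j]; first by rewrite mulr_ge0 ?B0.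
  by rewrite dotv_sub_sym mulrA (mulrC _ 4) co.
rewrite -(sum_perm (fun j => 4 * B j z xs) s).
apply: dotv_sum_le => [//|j|j]; first by rewrite mulr_ge0 ?B0.
by rewrite mulrA (mulrC _ 4) co.
Qed.

Lemma epoch_descent (s : 'S_n) x x' z :
  32 * (n%:R * eta * Lbar L) ^+ 2 <= 1 ->
  psi z \is a fin_num ->
  is_argmin (prox_obj n psi eta (inner_pass g eta s x)) x' ->
  2 * eta * n%:R * (favg fs x' + fine (psi x') - (favg fs z + fine (psi z))) <=
    dotv (z - x) (z - x) - dotv (z - x') (z - x')
    + 2 * eta * n%:R * (24 * (n%:R * eta * Lbar L) ^+ 2 *
        (favg fs z + fine (psi z) - (favg fs xs + fine (psi xs))))
    + 12 * eta ^+ 3 * prefix_noise s.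
Proof.
move=> small hz argx.
have prox := prox_three_point argx hz.
have [y [yE wE]] := inner_pass_iterates g eta s x.
have drift := inner_drift z yE; rewrite {}wE in prox argx.
set G := \sum_j g (s j) (y j) in prox.
have nR : n%:R != 0 :> R by rewrite pnatr_eq0 -lt0n.
have favgE u : n%:R * favg fs u = \sum_i fs (s i) u.
  by rewrite mulrA mulfV ?mul1r // (sum_perm (fs^~ u)).
(* Linearising at [y j] leaves two Bregman sums: the one at [z] has the favourable sign and pays for
   the drift, the one at [x'] has to be bounded. *)
have GE : dotv G (z - x') = n%:R * favg fs z - n%:R * favg fs x'
    - \sum_j B (s j) z (y j) + \sum_j B (s j) x' (y j).
  rewrite !favgE dotv_suml -!sumrB -big_split /=; apply: eq_bigr => j _.
  by rewrite /bregman !dotvDr !dotvNr; ring.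
have G2 : dotv (z - (x - eta *: G)) (z - (x - eta *: G))
    - dotv (x' - (x - eta *: G)) (x' - (x - eta *: G)) =
    dotv (z - x) (z - x) - dotv (x' - x) (x' - x) + 2 * eta * dotv G (z - x').
  move: (G) => H; rewrite !dotvE (dotvC H x) (dotvC H z) (dotvC H x').
  by rewrite (dotvC x z) (dotvC x' x); ring.
rewrite {}G2 {}GE in prox.
have BX := bregman_opt_le hz.
(* Smoothness gives [L |x' - y j|^2], split through [x]. The 24 is 2 from this splitting, 3 from the
   three drift terms and 4 from cocoercivity. *)
have up : \sum_j B (s j) x' (y j) <= 2 * (n%:R * Lbar L) * dotv (x' - x) (x' - x)
    + 24 * (eta * (n%:R * Lbar L)) ^+ 2 *
        (\sum_j B (s j) z (y j) + \sum_j B j z xs)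
    + 6 * eta ^+ 2 * prefix_noise s.
  pose c := 4 * (n%:R * Lbar L) * (\sum_j B (s j) z (y j) + \sum_j B j z xs).
  apply: (@le_trans _ _ (\sum_j (L (s j) * (2 * dotv (x' - x) (x' - x)
      + 6 * eta ^+ 2 * c) + 6 * eta ^+ 2 * (L (s j) *
      dotv (\sum_(k < n | (k < j)%N) g (s k) xs)
           (\sum_(k < n | (k < j)%N) g (s k) xs))))).
    apply: ler_sum => j _.
    apply: le_trans (bregman_le (fs_convex _) (fs_grad _) (L0 _) (g_lip _) _ _) _.
    rewrite [6 * eta ^+ 2 * (L _ * _)]mulrCA -mulrDr; apply: ler_wpM2l; first exact: ltW.
    have -> : x' - y j = (x' - x) - (y j - x).
      by rewrite opprB addrA subrK.
    apply: le_trans (dotvD_le2 _ _) _.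
    by rewrite dotvNl dotvNr opprK; have := drift j; rewrite /c; lra.
  rewrite big_split /= -mulr_sumr -mulr_suml (sum_perm L) sum_Lbar.
  by rewrite -/(prefix_noise s) /c; lra.
have Lb0 := Lbar_gt0.
have nn : 0 < n%:R :> R by rewrite ltr0n.
set q := n%:R * eta * Lbar L in small *.
have q0 : 0 < q by apply: mulr_gt0 => //; exact: mulr_gt0.
have q4 : 4 * q <= 1 by nra.
have Bz : 0 <= \sum_j B (s j) z (y j).
  by apply: sumr_ge0 => j _; exact: bregman_ge0.
have X0 := dotv_ge0 (x' - x).
rewrite (_ : eta * (n%:R * Lbar L) = q) in up; last by rewrite /q; ring.
have {}up := ler_wpM2l (ltW (mulr_gt0 (ltr0n R 2) eta0)) up.
(* The errors are disposed of in turn: [e1] by the [- |x' - x|^2] of the prox step, since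
   [4 q <= 1]; [e2] by the favourable Bregman sum, since [24 q^2 <= 1]; [e3] by [bregman_opt_le],
   which leaves the gap of [z]. *)
have e1 : 2 * eta * (2 * (n%:R * Lbar L) * dotv (x' - x) (x' - x)) <=
    dotv (x' - x) (x' - x).
  rewrite (_ : _ * _ = (4 * q) * dotv (x' - x) (x' - x)); last by rewrite /q; ring.
  by rewrite ler_piMl.
have q24 : 24 * q ^+ 2 <= 1 by have := sqr_ge0 q; lra.
have e2 : 2 * eta * (24 * q ^+ 2 * \sum_j B (s j) z (y j)) <=
    2 * eta * \sum_j B (s j) z (y j).
  apply: ler_wpM2l; first by rewrite mulr_ge0 ?(ltW eta0).
  by apply: ler_piMl.
have e3 : 2 * eta * (24 * q ^+ 2 * \sum_j B j z xs) <= 2 * eta * (24 * q ^+ 2 *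
    (n%:R * (favg fs z + fine (psi z) - (favg fs xs + fine (psi xs))))).
  apply: ler_wpM2l; first by rewrite mulr_ge0 ?(ltW eta0).
  by apply: ler_wpM2l => //; rewrite mulr_ge0 ?sqr_ge0.
clear -up prox e1 e2 e3.
move: up prox e1 e2 e3.
move: (\sum_j B (s j) x' (y j)) (\sum_j B (s j) z (y j)) (\sum_j B j z xs).
move: (dotv (x' - x) (x' - x)) (dotv (z - x) (z - x)) (dotv (z - x') (z - x')).
move: (prefix_noise s) (favg fs z) (favg fs x') (favg fs xs) (fine _) (fine _).
move: (fine _) (n%:R : R) (Lbar L) q => *; lra.
Qed.

End Epoch.

(** * From averages to the last iterate *)

Section LastIterate.
Variable R : realType.
Implicit Types (K l m : nat) (r : nat -> R).

Definition suffix_sum K r l : R := \sum_(K - l <= k < K) r k.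

(** The first term is the noise in the mean over the whole run; the weight [1 / (l (l + 1))] pays
    for passing from the last [l + 1] iterates to the last [l]. Being linear and monotone in [r], it
    commutes with expectations and accepts termwise bounds. *)
Definition suffix_noise K r : R := K%:R^-1 * suffix_sum K r K
  + \sum_(1 <= l < K) (l%:R * l.+1%:R)^-1 * suffix_sum K r l.

Lemma suffix_sumS K r l : (l < K)%N ->
  suffix_sum K r l.+1 = r (K - l.+1)%N + suffix_sum K r l.
Proof.
move=> lK; rewrite /suffix_sum big_ltn; last by lia.
by rewrite (_ : (K - l.+1).+1 = K - l)%N //; lia.
Qed.

Lemma suffix_sum_const K l (M : R) : (l <= K)%N ->
  suffix_sum K (fun=> M) l = l%:R * M.
Proof.
move=> lK; rewrite /suffix_sum sumr_const_nat mulr_natl; congr (_ *+ _); lia.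
Qed.

Lemma suffix_noise_le K r (r' : nat -> R) : (forall k, (k < K)%N -> r k <= r' k) ->
  suffix_noise K r <= suffix_noise K r'.
Proof.
move=> le; have S l : suffix_sum K r l <= suffix_sum K r' l.
  by apply: ler_sum_nat => k /andP[_]; exact: le.
apply: lerD; first by rewrite ler_wpM2l ?invr_ge0.
by apply: ler_sum => l _; rewrite ler_wpM2l ?invr_ge0 ?mulr_ge0.
Qed.

Lemma suffix_noise_sum K (I : finType) (p : I -> R) (r : I -> nat -> R) :
  \sum_i p i * suffix_noise K (r i) =
  suffix_noise K (fun k => \sum_i p i * r i k).
Proof.
have S l : \sum_i p i * suffix_sum K (r i) l =
    suffix_sum K (fun k => \sum_i p i * r i k) l.
  by rewrite /suffix_sum exchange_big; apply: eq_bigr => i _; rewrite mulr_sumr.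
have S2 : \sum_(1 <= l < K) (l%:R * l.+1%:R)^-1 *
      suffix_sum K (fun k => \sum_i p i * r i k) l =
    \sum_i p i * \sum_(1 <= l < K) (l%:R * l.+1%:R)^-1 * suffix_sum K (r i) l.
  under [RHS]eq_bigr do rewrite mulr_sumr.
  rewrite exchange_big; apply: eq_bigr => l _; rewrite -S mulr_sumr.
  by apply: eq_bigr => i _; rewrite mulrCA.
rewrite /suffix_noise S2 -S mulr_sumr -big_split; apply: eq_bigr => i _ /=.
by rewrite mulrDr mulrCA.
Qed.

(** Induction on [1 / (m + 1) <= ln ((m + 1) / m)], which is [ln (1 + x) <= x] at
    [x = - 1 / (m + 1)]. *)
Lemma sum_harmonic_le_ln K : (0 < K)%N ->
  \sum_(1 <= l < K) (l.+1%:R)^-1 <= ln K%:R :> R.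
Proof.
elim: K => // -[|K] IH _; first by rewrite big_geq // ln1.
rewrite big_nat_recr //=; apply: (@le_trans _ _ (ln K.+1%:R + K.+2%:R^-1)).
  by rewrite lerD2r IH.
have K1 : 0 < K.+1%:R :> R by rewrite ltr0n.
have K2 : 0 < K.+2%:R :> R by rewrite ltr0n.
have bE : K.+2%:R = K.+1%:R + 1 :> R by rewrite natr1.
have xE : 1 + (K.+1%:R / K.+2%:R - 1) = K.+1%:R / K.+2%:R :> R.
  by rewrite addrCA subrr addr0.
have := @le_ln1Dx R (K.+1%:R / K.+2%:R - 1).
rewrite xE ln_div ?posrE // ltrBDl subrr divr_gt0 // => /(_ isT).
have -> : K.+1%:R / K.+2%:R - 1 = - (K.+2%:R)^-1 :> R.
  move: bE K2; move: (K.+2%:R : R) (K.+1%:R : R) => b a -> b0.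
  by field; rewrite gt_eqF.
by rewrite lerBlDr (addrC (- _)) lerBrDr.
Qed.

Lemma suffix_noise_const K (M : R) : (0 < K)%N ->
  suffix_noise K (fun=> M) = M * (1 + \sum_(1 <= l < K) (l.+1%:R)^-1).
Proof.
move=> K0; rewrite /suffix_noise suffix_sum_const // mulKf ?pnatr_eq0 -?lt0n //.
rewrite mulrDr mulr1 mulr_sumr; congr (_ + _); apply: eq_big_nat => l /andP[l1 lK].
rewrite suffix_sum_const ?(ltnW lK) //.
have : l%:R != 0 :> R by rewrite pnatr_eq0 -lt0n.
have : l.+1%:R != 0 :> R by rewrite pnatr_eq0.
by move: (l.+1%:R : R) (l%:R : R) => a b a0 b0; field; rewrite a0 b0.
Qed.

(* [S l] is the mean of the last [l] values; each hypothesis of index [a] bounds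
   [S (K - a)] by the value preceding the suffix, so that the means grow slowly
   as the suffix shrinks. *)
Lemma last_le_suffix_noise K (delta r : nat -> R) (A al : R) : (0 < K)%N ->
  (forall k, (k <= K)%N -> 0 <= delta k) -> (forall k, 0 <= r k) -> 0 <= al <= 1 ->
  \sum_(0 <= k < K) delta k.+1 <= A + \sum_(0 <= k < K) r k ->
  (forall a, (a < K)%N -> \sum_(a <= k < K) delta k.+1 <=
     (K - a)%:R * (1 + al) * delta a + \sum_(a <= k < K) r k) ->
  (1 - al * \sum_(1 <= l < K) (l.+1%:R)^-1) * delta K <=
    A / K%:R + suffix_noise K r.
Proof.
move=> K0 d0 r0 /andP[al0 al1] H1 H2.
pose T := suffix_sum K (fun k => delta k.+1); pose rho := suffix_sum K r.
have T0 l : 0 <= T l.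
  by rewrite /T /suffix_sum big_nat; apply: sumr_ge0 => k /andP[_]; exact: d0.
have rho0 l : 0 <= rho l by apply: sumr_ge0.
pose S l := l%:R^-1 * T l.
have S0 l : 0 <= S l by rewrite mulr_ge0 ?invr_ge0.
pose Q m := \sum_(1 <= l < m) (l%:R * l.+1%:R)^-1 * rho l.
have Q0 m : 0 <= Q m by apply: sumr_ge0 => l _; rewrite mulr_ge0 ?invr_ge0 ?mulr_ge0.
(* Cleared of denominators, the claim is [(1 - al) T l <= l delta (K - l) + rho l]. It is the
   hypothesis on the suffix times [1 - al], because [(1 - al) (1 + al) <= 1]. *)
have step l : (0 < l)%N -> (l < K)%N ->
    (1 - al / l.+1%:R) * S l <= S l.+1 + (l%:R * l.+1%:R)^-1 * rho l.
  move=> l0 lK.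
  have TS : T l.+1 = delta (K - l)%N + T l.
    by rewrite /T suffix_sumS // (_ : (K - l.+1).+1 = K - l)%N //; lia.
  have H : T l <= l%:R * (1 + al) * delta (K - l)%N + rho l.
    rewrite -[in l%:R](_ : K - (K - l) = l)%N; last by lia.
    by apply: H2; lia.
  have dp := d0 _ (leq_subr l K).
  have a0 : 0 < l%:R :> R by rewrite ltr0n.
  have b0 : 0 < l.+1%:R :> R by rewrite ltr0n.
  have ba : l.+1%:R = l%:R + 1 :> R by rewrite -natr1.
  rewrite /S TS; move: dp (T0 l) (rho0 l) H.
  move: a0 b0 ba; move: (l.+1%:R : R) (l%:R : R) => b a a0 b0 ba.
  move: (delta (K - l)%N) (T l) (rho l) => e t p e0 t0 p0 H.
  rewrite -(ler_pM2l (mulr_gt0 a0 b0)).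
  have -> : a * b * ((1 - al / b) * (a^-1 * t)) = (b - al) * t.
    by field; rewrite !gt_eqF.
  have -> : a * b * (b^-1 * (e + t) + (a * b)^-1 * p) = a * (e + t) + p.
    by field; rewrite !gt_eqF.
  have al2 : 0 <= 1 - al by rewrite subr_ge0.
  have h1 := ler_wpM2l al2 H.
  have h2 : 0 <= al ^+ 2 * (a * e) by rewrite mulr_ge0 ?sqr_ge0 ?mulr_ge0 ?(ltW a0).
  have h3 : 0 <= al * p by rewrite mulr_ge0.
  by rewrite ba; lra.
(* Chains the steps, using that the product of the [1 - al / (l + 1)] is at least one minus the sum
   of the [al / (l + 1)]; [h2] and [h3] are the cross terms dropped on the way. *)
have main m : (0 < m <= K)%N ->
    (1 - al * \sum_(1 <= l < m) (l.+1%:R)^-1) * S 1%N <= S m + Q m.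
  elim: m => // -[_ _|m IH /andP[_ mK]].
    by rewrite /Q !big_geq // mulr0 subr0 mul1r addr0.
  have {}IH := IH (ltnW mK); have := step m.+1 isT mK.
  have -> : Q m.+2 = Q m.+1 + (m.+1%:R * m.+2%:R)^-1 * rho m.+1.
    by rewrite /Q big_nat_recr.
  rewrite [\sum_(1 <= l < m.+2) _]big_nat_recr //=.
  have b2 : 2 <= m.+2%:R :> R by rewrite ler_nat.
  have c0 : 0 <= al / m.+2%:R by rewrite divr_ge0.
  have c1 : al / m.+2%:R <= 1 by rewrite ler_pdivrMr; lra.
  have h0 : 0 <= \sum_(1 <= i < m.+1) (i.+1%:R)^-1 :> R.
    by apply: sumr_ge0 => i _; rewrite invr_ge0.
  have c2 : 0 <= 1 - al / m.+2%:R by rewrite subr_ge0.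
  have h1 := ler_wpM2l c2 IH.
  have h2 := mulr_ge0 c0 (Q0 m.+1).
  have h3 := mulr_ge0 (mulr_ge0 c0 (mulr_ge0 al0 h0)) (S0 1%N).
  move: h1 h2 h3.
  move: (m.+2%:R^-1 : R) (_^-1 * rho m.+1) (S m.+1) (S m.+2) (S 1%N) (Q m.+1).
  move: (\sum_(1 <= i < m.+1) (i.+1%:R)^-1 : R) => *; lra.
have := main K; rewrite K0 leqnn => /(_ isT).
have -> : S 1%N = delta K.
  rewrite /S /T suffix_sumS //= {1}/suffix_sum subn0 big_geq // addr0 invr1 mul1r.
  by congr delta; lia.
move/le_trans; apply; rewrite /suffix_noise addrA lerD2r /S (mulrC A) -mulrDr.
by rewrite ler_wpM2l ?invr_ge0 // /T /suffix_sum subnn.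
Qed.

End LastIterate.

(** * Noise of a random permutation and choice of the stepsize *)

Lemma ler_sum_sub (R : realType) (I : finType) (A B : pred I) (F G : I -> R) :
  (forall i, A i -> B i) -> (forall i, A i -> F i <= G i) ->
  (forall i, B i -> 0 <= G i) ->
  \sum_(i | A i) F i <= \sum_(i | B i) G i.
Proof.
move=> AB FG G0; rewrite [leLHS]big_mkcond [leRHS]big_mkcond /=.
apply: ler_sum => i _; case: ifP => [Ai|_]; first by rewrite AB ?FG.
by case: ifP => // /G0.
Qed.

(* The off-diagonal entries share a sign: if they are nonpositive, drop them;
   otherwise enlarge the index set from [A] to [B]. *)
Lemma exchangeable_sum_le (R : realType) (I : finType) (A B : pred I)
    (c : I -> I -> R) :
  (forall j, A j -> B j) -> (forall j, 0 <= c j j) ->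
  (forall j k j' k', B j -> B k -> B j' -> B k' -> j != k -> j' != k' ->
     c j k = c j' k') ->
  0 <= \sum_(j | B j) \sum_(k | B k) c j k ->
  \sum_(j | A j) \sum_(k | A k) c j k <=
    \sum_(j | B j) c j j + \sum_(j | B j) \sum_(k | B k) c j k.
Proof.
move=> AB diag exch tot.
have [/existsP[[j0 k0] /= /and4P[Bj Bk jk c0]]|/existsPn neg] :=
    boolP [exists p : I * I, [&& B p.1, B p.2, p.1 != p.2 & 0 < c p.1 p.2]].
  have cge0 j k : B j -> B k -> 0 <= c j k.
    move=> hj hk; have [<-|njk] := eqVneq j k; first exact: diag.
    by rewrite (exch j k j0 k0) // ltW.
  apply: ler_wpDl; first by apply: sumr_ge0.
  apply: ler_sum_sub => // [j Aj|j Bj']; last by apply: sumr_ge0 => k; exact: cge0.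
  by apply: ler_sum_sub => // k; apply: cge0; exact: AB.
apply: ler_wpDr => //; apply: ler_sum_sub => // j Aj.
rewrite (bigD1 j) //= gerDl; apply: sumr_le0 => k /andP[Ak kj].
by have := neg (j, k); rewrite /= !AB // eq_sym kj /= -leNgt.
Qed.

Section PermutationNoise.
Variables (R : realType) (n d : nat).
Variables (g : 'I_n -> 'rV[R]_d -> 'rV[R]_d) (L : 'I_n -> R) (xs : 'rV[R]_d).
Hypotheses (n0 : (0 < n)%N) (L0 : forall i, 0 < L i).

Local Notation v i := (g i xs).
Local Notation Q := (\sum_i dotv (v i) (v i)).
Local Notation S := (\sum_i v i).

Lemma prefix_noise_ge0 (s : 'S_n) : 0 <= prefix_noise g L xs s.
Proof.
by apply: sumr_ge0 => i _; rewrite mulr_ge0 ?dotv_ge0 ?(ltW (L0 _)).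
Qed.

(** Worst case: [dotv_sum_le] with unit weights bounds every prefix by the full sum of squared
    norms. *)
Lemma prefix_noise_le (s : 'S_n) :
  prefix_noise g L xs s <= n%:R * Lbar L * (n%:R * Q).
Proof.
rewrite -(sum_Lbar L n0) -(sum_perm L s) mulr_suml; apply: ler_sum => i _.
apply: ler_wpM2l; first exact: ltW.
have -> : n%:R = \sum_(j < n) 1 :> R by rewrite sumr_const card_ord.
rewrite -(sum_perm (fun j => dotv (v j) (v j)) s).
by apply: dotv_sum_le => [//|j|j]; [exact: dotv_ge0 | rewrite mul1r].
Qed.

(** With the weight [L (s i)] attached, the positions other than [i] are still exchangeable, so the
    prefix compares with the set of all of them, whose sum is [S - v (s i)]. In [3 Q], one [Q] is
    the diagonal and two bound [2 |v (s i)|^2]. *)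
Lemma sum_perm_prefix_le (i : 'I_n) :
  \sum_(s : 'S_n) L (s i) * dotv (\sum_(j < n | (j < i)%N) v (s j))
                                  (\sum_(j < n | (j < i)%N) v (s j)) <=
  \sum_(s : 'S_n) L (s i) * (3 * Q + 2 * dotv S S).
Proof.
pose c j k := \sum_(s : 'S_n) L (s i) * dotv (v (s j)) (v (s k)).
have cE (A : pred 'I_n) : \sum_(s : 'S_n) L (s i) *
      dotv (\sum_(j | A j) v (s j)) (\sum_(j | A j) v (s j)) =
    \sum_(j | A j) \sum_(k | A k) c j k.
  rewrite /c; under [RHS]eq_bigr do rewrite exchange_big /=.
  rewrite [RHS]exchange_big /=; apply: eq_bigr => s _.
  rewrite dotv_suml mulr_sumr; apply: eq_bigr => j _.
  by rewrite dotv_sumr mulr_sumr.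
have cperm (t : 'S_n) j k : t i = i -> c (t j) (t k) = c j k.
  move=> ti; rewrite [RHS](reindex_inj (mulgI t)); apply: eq_bigr => s _.
  by rewrite !permM ti.
have cC j k : c j k = c k j by apply: eq_bigr => s _; rewrite dotvC.
(* The transposition of [k] and [k'] fixes both [i] and [j]. *)
have csub j k k' : j != i -> k != i -> k' != i -> j != k -> j != k' -> c j k = c j k'.
  move=> ji ki k'i jk jk'; rewrite -(cperm (tperm k k') j k') ?tpermR //.
    by rewrite tpermD // eq_sym.
  by rewrite tpermD.
(* One index changes at a time, through the pairs [(j, k)], [(k, j')], [(j', k')]; the middle pair
   is degenerate when [k = j'], where a single change suffices. *)
have exch j k j' k' : j != i -> k != i -> j' != i -> k' != i ->
    j != k -> j' != k' -> c j k = c j' k'.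
  move=> ji ki j'i k'i jk jk'; have [kj'|kj'] := eqVneq k j'.
    by rewrite cC kj' (csub j' j k') // eq_sym -kj'.
  have kj : k != j by rewrite eq_sym.
  by rewrite cC (csub k j j') // cC (csub j' k k') // eq_sym.
have L0' (s : 'S_n) : 0 <= L (s i) by exact: ltW.
have v_le k : dotv (v k) (v k) <= Q.
  by rewrite (bigD1 k) //= lerDl sumr_ge0 // => j _; exact: dotv_ge0.
rewrite cE.
apply: (@le_trans _ _ (\sum_(j | j != i) c j j
    + \sum_(j | j != i) \sum_(k | k != i) c j k)).
  apply: exchangeable_sum_le => //.
  - by move=> j ji; rewrite -val_eqE neq_ltn ji.
  - by move=> j; apply: sumr_ge0 => s _; rewrite mulr_ge0 ?dotv_ge0.
  - by rewrite -cE; apply: sumr_ge0 => s _; rewrite mulr_ge0 ?dotv_ge0.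
rewrite -cE exchange_big /= -big_split /=; apply: ler_sum => s _.
rewrite -mulr_sumr -mulrDr; apply: ler_wpM2l => //.
have -> : \sum_(j | j != i) v (s j) = S - v (s i).
  by rewrite [in RHS](reindex_perm s) [in RHS](bigD1 i) //= addrAC subrr add0r.
have := dotvD_le2 S (- v (s i)); rewrite dotvNl dotvNr opprK => h1.
have h2 : \sum_(j | j != i) dotv (v (s j)) (v (s j)) <= Q.
  rewrite [leRHS](reindex_perm s) [leRHS](bigD1 i) //= lerDr; exact: dotv_ge0.
have := v_le (s i); lra.
Qed.

Lemma mean_prefix_noise_le :
  (n`!%:R)^-1 * \sum_(s : 'S_n) prefix_noise g L xs s <=
    n%:R * Lbar L * (3 * Q + 2 * dotv S S).
Proof.
have f0 : 0 < n`!%:R :> R by rewrite ltr0n fact_gt0.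
rewrite ler_pdivrMl //; under eq_bigr do rewrite /prefix_noise.
rewrite exchange_big /=.
apply: le_trans (ler_sum _ (fun i _ => sum_perm_prefix_le i)) _.
rewrite exchange_big /=.
under eq_bigr do rewrite -mulr_suml sum_perm (sum_Lbar L n0).
rewrite sumr_const (_ : #|_| = n`!) ?mulr_natl //.
by rewrite -card_Sn; apply: eq_card.
Qed.

End PermutationNoise.

(** Grouping the outcomes by the permutation of epoch [k] leaves only the marginal law of that
    epoch. *)
Lemma uniform_marginals_mean (R : realType) (n K : nat)
    (P : {ffun 'I_K -> 'S_n} -> R) (k : 'I_K) (h : 'S_n -> R) :
  uniform_marginals P ->
  \sum_w P w * h (w k) = (n`!%:R)^-1 * \sum_s h s.
Proof.
move=> [_ [_ unif]].
rewrite (partition_big (fun w : {ffun 'I_K -> 'S_n} => w k) xpredT) //=.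
rewrite mulr_sumr; apply: eq_bigr => s _; rewrite -(unif k s) mulr_suml.
by apply: eq_bigr => w /eqP ->.
Qed.

Section StepsizeTradeoff.
Variable R : realType.

Lemma powR_third (x : R) (m : nat) : 0 <= x ->
  x `^ (m%:R / 3) = (x `^ (3^-1)) ^+ m.
Proof. by move=> x0; rewrite mulrC powRrM powR_mulrn ?powR_ge0. Qed.

Lemma powR_third_cube (x : R) : 0 <= x -> (x `^ (3^-1)) ^+ 3 = x.
Proof. by move=> x0; rewrite -powR_third // divff // powRr1. Qed.

(** In terms of cube roots everything is rational. At the second candidate both terms equal [B]. If
    the first candidate is the smaller one, the noise term is still at most [B] by monotonicity, and
    the distance term is [4 sqrt 2 A <= 6 A]. *)
Lemma stepsize_tradeoff (D Lb Ls lK s n K : R) (eta : R) :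
  0 < D -> 0 < Lb -> 0 < Ls -> 0 < lK -> 0 < s -> 0 < n -> 0 < K ->
  eta = Num.min (4 * n * Num.sqrt (2 * Lb * Ls * lK))^-1
          (D `^ (2 / 3) / (n * (Lb * s * K * lK) `^ (3^-1))) ->
  D ^+ 2 / (n * eta * K) + (n * eta) ^+ 2 * Lb * s * lK <=
    6 * (D ^+ 2 * Num.sqrt (Lb * Ls * lK) / K)
    + 2 * (D `^ (4 / 3) * (Lb * s * lK) `^ (3^-1) / K `^ (2 / 3)).
Proof.
move=> D0 Lb0 Ls0 lK0 s0 n0 K0.
have Z0 : 0 < Lb * s * lK by rewrite !mulr_gt0.
have W0 : 0 < Lb * Ls * lK by rewrite !mulr_gt0.
rewrite !powR_third ?(ltW D0) ?(ltW K0) //.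
have -> : (Lb * s * K * lK) `^ (3^-1) = (Lb * s * lK) `^ 3^-1 * K `^ 3^-1.
  by rewrite -powRM ?(ltW Z0) ?(ltW K0) //; congr (_ `^ _); ring.
have -> : (n * eta) ^+ 2 * Lb * s * lK = (n * eta) ^+ 2 * (Lb * s * lK) by ring.
have -> : Num.sqrt (2 * Lb * Ls * lK) = Num.sqrt 2 * Num.sqrt (Lb * Ls * lK).
  by rewrite -sqrtrM //; congr Num.sqrt; ring.
have q0 : 0 < Num.sqrt (Lb * Ls * lK) by rewrite sqrtr_gt0.
have q2 : Num.sqrt 2 <= 3 / 2 :> R.
  rewrite -[leRHS]ger0_norm ?divr_ge0 // -sqrtr_sqr ler_wsqrtr //; lra.
have q2' : 0 < Num.sqrt 2 :> R by rewrite sqrtr_gt0.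
rewrite -[in D ^+ 2](powR_third_cube (ltW D0)) -[in n * eta * K](powR_third_cube (ltW K0)).
rewrite -[in _ / K](powR_third_cube (ltW K0)).
rewrite -[in _ * (Lb * s * lK)](powR_third_cube (ltW Z0)).
have := powR_gt0 (3^-1) D0; have := powR_gt0 (3^-1) K0; have := powR_gt0 (3^-1) Z0.
move: q0 q2 q2'.
move: (Num.sqrt _) (Num.sqrt 2) (D `^ _) (K `^ _) ((Lb * s * lK) `^ _).
move=> q r a c b q0 r2 r0 b0 c0 a0 etaE.
set A := (a ^+ 3) ^+ 2 * q / c ^+ 3; set B := a ^+ 4 * b / c ^+ 2.
have A0 : 0 <= A by rewrite !mulr_ge0 ?invr_ge0 ?exprn_ge0 ?ltW.
have B0 : 0 <= B by rewrite !mulr_ge0 ?invr_ge0 ?exprn_ge0 ?ltW.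
have nz := (gt_eqF q0, gt_eqF r0, gt_eqF a0, gt_eqF b0, gt_eqF c0, gt_eqF n0).
set e0 := (4 * n * (r * q))^-1 in etaE.
set e1 := a ^+ 2 / (n * (b * c)) in etaE.
have e0_gt0 : 0 < e0 by rewrite invr_gt0 !mulr_gt0.
have e1_gt0 : 0 < e1 by rewrite divr_gt0 ?exprn_gt0 // !mulr_gt0.
have B1 : (a ^+ 3) ^+ 2 / (n * e1 * c ^+ 3) = B.
  by rewrite /e1 /B; field; rewrite !nz.
have B2 : (n * e1) ^+ 2 * b ^+ 3 = B by rewrite /e1 /B; field; rewrite !nz.
have A1 : (a ^+ 3) ^+ 2 / (n * e0 * c ^+ 3) = 4 * r * A.
  by rewrite /e0 /A; field; rewrite !nz.
have rA : r * A <= 3 / 2 * A by rewrite ler_wpM2r.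
move: etaE; rewrite minEle; case: ifP => [e01|_] ->; last by rewrite B1 B2; lra.
rewrite A1; have : (n * e0) ^+ 2 * b ^+ 3 <= B; last by lra.
rewrite -B2 ler_wpM2r ?exprn_ge0 ?(ltW b0) //.
apply: lerXn2r; rewrite ?nnegrE ?ler_pM2l //.
  by rewrite mulr_ge0 ?(ltW n0) ?(ltW e0_gt0).
by rewrite mulr_ge0 ?(ltW n0) ?(ltW e1_gt0).
Qed.

End StepsizeTradeoff.

(** * Complete runs *)

Section Run.
Variables (R : realType) (n d : nat) (fs : 'I_n -> 'rV[R]_d -> R).
Variables (g : 'I_n -> 'rV[R]_d -> 'rV[R]_d) (L : 'I_n -> R).
Variables (psi : 'rV[R]_d -> \bar R) (xs x1 : 'rV[R]_d) (K : nat) (eta : R).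
Hypotheses (n0 : (0 < n)%N) (K0 : (0 < K)%N) (eta0 : 0 < eta).
Hypothesis fs_convex : forall i, convex_fun (fs i).
Hypothesis fs_grad : forall i x, is_gradient (fs i) (g i x) x.
Hypothesis L0 : forall i, 0 < L i.
Hypothesis g_lip : forall i x y, enorm (g i x - g i y) <= L i * enorm (x - y).
Hypothesis psi_proper : proper_fun psi.
Hypothesis psi_convex : convex_efun psi.
Hypothesis xs_dom : psi xs \is a fin_num.
Hypothesis xs_min : forall x, (Fobj fs psi xs <= Fobj fs psi x)%E.
Hypothesis x1_dom : psi x1 \is a fin_num.
Hypothesis eta_le :
  eta <= (4 * n%:R * Num.sqrt (2 * Lbar L * Lstar L * (1 + ln K%:R)))^-1.

Local Notation gap x := (favg fs x + fine (psi x) - (favg fs xs + fine (psi xs))).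
Local Notation lK := (1 + ln K%:R : R).

Lemma lK_ge1 : 1 <= lK.
Proof. by rewrite lerDl ln_ge0 // ler1n. Qed.

Lemma Lbar_le_Lstar : Lbar L <= Lstar L.
Proof.
rewrite /Lbar mulrC ler_pdivrMr ?ltr0n // mulr_natr.
have -> : Lstar L *+ n = \sum_(i < n) Lstar L by rewrite sumr_const card_ord.
apply: ler_sum => i _.
exact: le_bigmax.
Qed.

(** Squaring the stepsize condition gives the bound with [Lbar * Lstar] in place of [Lbar^2], and
    [Lbar <= Lstar]. *)
Lemma stepsize_small : 32 * (n%:R * eta * Lbar L) ^+ 2 * lK <= 1.
Proof.
have l0 : 0 < lK := lt_le_trans ltr01 lK_ge1.
have nn : 0 < n%:R :> R by rewrite ltr0n.
move: eta_le (Lbar_gt0 n0 L0) (lt_le_trans (Lbar_gt0 n0 L0) Lbar_le_Lstar).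
move: Lbar_le_Lstar l0; move: (Lbar L) (Lstar L) lK => a b l ab l0 le a0 b0.
have Z0 : 0 < 2 * a * b * l by rewrite !mulr_gt0.
have q0 : 0 < 4 * n%:R * Num.sqrt (2 * a * b * l) by rewrite !mulr_gt0 ?sqrtr_gt0.
have : (eta * (4 * n%:R * Num.sqrt (2 * a * b * l))) ^+ 2 <= 1.
  rewrite expr_le1 //; last by rewrite mulr_ge0 ?(ltW eta0) ?(ltW q0).
  by rewrite -ler_pdivlMr // div1r.
rewrite !exprMn sqr_sqrtr ?(ltW Z0) //; apply: le_trans.
have h : 0 <= 32 * (n%:R * eta) ^+ 2 * l * a.
  by rewrite !mulr_ge0 ?sqr_ge0 ?(ltW l0) ?(ltW a0) ?(ltW eta0).
have := ler_wpM2l h ab.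
by move: (n%:R : R) => m; lra.
Qed.

Lemma gap_ge0 x : psi x \is a fin_num -> 0 <= gap x.
Proof.
move=> hx; have := xs_min x.
by rewrite /Fobj -(fineK xs_dom) -(fineK hx) -!EFinD lee_fin /= subr_ge0.
Qed.

(** The factor is the [12 eta^3] of [epoch_descent] divided by [2 eta n]. The identity is a default
    value for indices [k >= K], which lie outside the run. *)
Definition epoch_noise (sigma : 'I_K -> 'S_n) (k : nat) : R :=
  6 * eta ^+ 2 / n%:R *
  prefix_noise g L xs (if insub k is Some i then sigma i else 1%g).

Lemma run_last_gap (sigma : 'I_K -> 'S_n) (x : nat -> 'rV[R]_d) :
  prox_shuffling_run g psi eta x1 sigma x ->
  psi (x K.+1) \is a fin_num /\
  gap (x K.+1) <= 4 * (dotv (xs - x1) (xs - x1) / (2 * eta * n%:R) / K%:R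
                       + suffix_noise K (epoch_noise sigma)).
Proof.
move=> [x1E run]; pose r := epoch_noise sigma.
have nn : 0 < n%:R :> R by rewrite ltr0n.
have c0 : 0 < 2 * eta * n%:R by rewrite !mulr_gt0.
have fin k : (k <= K)%N -> psi (x k.+1) \is a fin_num.
  case: k => [|k kK]; first by rewrite x1E.
  exact: (prox_fin_num n0 psi_proper xs_dom (run (Ordinal kK))).
split; first exact: fin.
(* The ratio 24 / 32 gives [al * lK <= 3 / 4], so the final coefficient is at least [1 / 4]; this is
   the 4 of the statement. *)
pose al := 24 * (n%:R * eta * Lbar L) ^+ 2.
have al0 : 0 <= al by rewrite mulr_ge0 ?sqr_ge0.
have small := stepsize_small; have l1 := lK_ge1.
have al_lK : al * lK <= 3 / 4 by rewrite /al; lra.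
have al1 : al <= 3 / 4 by apply: le_trans al_lK; rewrite ler_peMr.
have small1 : 32 * (n%:R * eta * Lbar L) ^+ 2 <= 1.
  by apply: le_trans small; rewrite ler_peMr // mulr_ge0 ?sqr_ge0.
pose dist z k := dotv (z - x k.+1) (z - x k.+1).
have epoch z k : psi z \is a fin_num -> (k < K)%N ->
    gap (x k.+2) <= (1 + al) * gap z
      + (2 * eta * n%:R)^-1 * (dist z k - dist z k.+1) + r k.
  move=> hz kK.
  have := epoch_descent n0 eta0 fs_convex fs_grad L0 g_lip psi_proper psi_convex
    xs_dom xs_min small1 hz (run (Ordinal kK)).
  rewrite -/al /r /epoch_noise insubT /= -/(dist z k) -/(dist z k.+1) => H.
  rewrite -(ler_pM2l c0) !mulrDr !mulVKf ?gt_eqF //.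
  have -> : 2 * eta * n%:R * (6 * eta ^+ 2 / n%:R * prefix_noise g L xs (sigma (Ordinal kK)))
      = 12 * eta ^+ 3 * prefix_noise g L xs (sigma (Ordinal kK)).
    by field; rewrite gt_eqF.
  by move: H; lra.
have epochs z a : psi z \is a fin_num -> (a <= K)%N ->
    \sum_(a <= k < K) gap (x k.+2) <= (K - a)%:R * (1 + al) * gap z
      + (2 * eta * n%:R)^-1 * (dist z a - dist z K) + \sum_(a <= k < K) r k.
  move=> hz aK.
  have -> : (2 * eta * n%:R)^-1 * (dist z a - dist z K) =
      \sum_(a <= k < K) (2 * eta * n%:R)^-1 * (dist z k - dist z k.+1).
    rewrite -mulr_sumr -[in LHS]opprB -telescope_sumr // -sumrN.
    by congr (_ * _); apply: eq_bigr => k _; rewrite opprB.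
  have -> : (K - a)%:R * (1 + al) * gap z = \sum_(a <= k < K) (1 + al) * gap z.
    by rewrite sumr_const_nat -[RHS]mulr_natl mulrA.
  by rewrite -!big_split /=; apply: ler_sum_nat => k /andP[_ kK]; exact: epoch.
have dist_ge0 z k : 0 <= (2 * eta * n%:R)^-1 * dist z k.
  by rewrite mulr_ge0 ?dotv_ge0 // invr_ge0 ltW.
have r0 k : 0 <= r k.
  rewrite mulr_ge0 ?prefix_noise_ge0 // divr_ge0 // mulr_ge0 ?sqr_ge0 //.
(* With [z = xs] the gap of [z] vanishes and the initial distance remains; in [H2], with [z] the
   iterate before the suffix, the initial distance vanishes and the gap remains. *)
have H1 : \sum_(0 <= k < K) gap (x k.+2) <=
    (2 * eta * n%:R)^-1 * dotv (xs - x1) (xs - x1) + \sum_(0 <= k < K) r k.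
  have := epochs xs 0%N xs_dom (leq0n K); have := dist_ge0 xs K.
  by rewrite subrr mulr0 add0r {2}/dist x1E; lra.
have H2 a : (a < K)%N -> \sum_(a <= k < K) gap (x k.+2) <=
    (K - a)%:R * (1 + al) * gap (x a.+1) + \sum_(a <= k < K) r k.
  move=> aK; have := epochs (x a.+1) a (fin a (ltnW aK)) (ltnW aK).
  have := dist_ge0 (x a.+1) K.
  have -> : dist (x a.+1) a = 0 by rewrite /dist subrr -(scale0r 0) dotvZl mul0r.
  lra.
have al01 : 0 <= al <= 1 by rewrite al0 /=; lra.
have gap0 k : (k <= K)%N -> 0 <= gap (x k.+1) by move=> kK; exact: gap_ge0 (fin k kK).
(* Here [delta k] is the gap at [x k.+1], so [delta K] belongs to the output [x K.+1]. *)
have := last_le_suffix_noise K0 gap0 r0 al01 H1 H2.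
have hl := sum_harmonic_le_ln R K0.
have : al * \sum_(1 <= l < K) (l.+1%:R)^-1 <= 3 / 4.
  apply: le_trans al_lK; apply: ler_wpM2l => //.
  by apply: le_trans hl _; rewrite lerDr.
move=> hal; have g0 := gap0 K (leqnn K).
have : 4^-1 * gap (x K.+1) <=
    (1 - al * \sum_(1 <= l < K) (l.+1%:R)^-1) * gap (x K.+1).
  by apply: ler_wpM2r => //; lra.
rewrite (mulrC _ (dotv _ _)); lra.
Qed.

(** Shared by both cases: [sg2] is [sigma2_any] for arbitrary permutations and [sigma2_rand / n] for
    random ones. The 72 is 4 times 18. *)
Lemma noise_bound (sg2 : R) (r : nat -> R) :
  (forall k, (k < K)%N -> r k <= 18 * (n%:R * eta) ^+ 2 * Lbar L * sg2) ->
  0 <= sg2 ->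
  4 * (dotv (xs - x1) (xs - x1) / (2 * eta * n%:R) / K%:R + suffix_noise K r) <=
  72 * (enorm (xs - x1) ^+ 2 / (n%:R * eta * K%:R)
        + (n%:R * eta) ^+ 2 * Lbar L * sg2 * lK).
Proof.
move=> rle sg0.
have := suffix_noise_le rle; rewrite suffix_noise_const //.
set M := 18 * _ * _ * _ => h1.
have M0 : 0 <= M.
  rewrite /M; move: (Lbar L) (Lbar_gt0 n0 L0) => a a0.
  by rewrite !mulr_ge0 ?sqr_ge0 ?(ltW a0) ?(ltW eta0).
have hl : 1 + \sum_(1 <= l < K) (l.+1%:R)^-1 <= lK by rewrite lerD2l sum_harmonic_le_ln.
have {}h1 := le_trans h1 (ler_wpM2l M0 hl).
have nn : 0 < n%:R :> R by rewrite ltr0n.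
have KK : 0 < K%:R :> R by rewrite ltr0n.
rewrite sqr_enorm.
have -> : dotv (xs - x1) (xs - x1) / (2 * eta * n%:R) / K%:R =
    2^-1 * (dotv (xs - x1) (xs - x1) / (n%:R * eta * K%:R)).
  by field; rewrite !gt_eqF.
have D0 : 0 <= dotv (xs - x1) (xs - x1) / (n%:R * eta * K%:R).
  by rewrite divr_ge0 ?dotv_ge0 // !mulr_ge0 ?(ltW eta0).
have -> : (n%:R * eta) ^+ 2 * Lbar L * sg2 * lK = 18^-1 * (M * lK).
  by rewrite /M; move: (ln _) => l; field.
move: D0 h1; move: (M * lK) (dotv _ _ / _) (suffix_noise _ _) => *; lra.
Qed.

Lemma sum_sqr_grad : \sum_i dotv (g i xs) (g i xs) = n%:R * sigma2_any g xs.
Proof.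
rewrite /sigma2_any mulrA mulfV ?mul1r ?pnatr_eq0 -?lt0n //.
by apply: eq_bigr => i _; rewrite sqr_enorm.
Qed.

Lemma sigma2_any_ge0 : 0 <= sigma2_any g xs.
Proof. by rewrite mulr_ge0 ?invr_ge0 ?sumr_ge0 // => i _; exact: sqr_ge0. Qed.

Lemma sigma2_rand_ge0 : 0 <= sigma2_rand g xs.
Proof. by rewrite addr_ge0 ?sigma2_any_ge0 // mulr_ge0 ?sqr_ge0. Qed.

Lemma adversarial_bound (sigma : 'I_K -> 'S_n) (x : nat -> 'rV[R]_d) :
  prox_shuffling_run g psi eta x1 sigma x ->
  (Fobj fs psi (x K.+1) - Fobj fs psi xs <=
    (72 * (enorm (xs - x1) ^+ 2 / (n%:R * eta * K%:R)
      + (n%:R * eta) ^+ 2 * Lbar L * sigma2_any g xs * lK))%:E)%E.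
Proof.
move=> /run_last_gap[fin le].
rewrite /Fobj -(fineK fin) -(fineK xs_dom) -!EFinD lee_fin /=.
apply: le_trans le _; apply: noise_bound sigma2_any_ge0 => k _.
set s : 'S_n := if insub k is Some i then sigma i else 1%g.
have := prefix_noise_le g xs n0 L0 s; rewrite sum_sqr_grad => h.
have nn : 0 < n%:R :> R by rewrite ltr0n.
have c0 : 0 <= 6 * eta ^+ 2 / n%:R by rewrite divr_ge0 // mulr_ge0 ?sqr_ge0.
apply: le_trans (ler_wpM2l c0 h) _.
have h2 : 0 <= (n%:R * eta) ^+ 2 * Lbar L * sigma2_any g xs.
  move: (Lbar L) (Lbar_gt0 n0 L0) (sigma2_any _ _) sigma2_any_ge0 => a a0 b b0.
  by rewrite !mulr_ge0 ?sqr_ge0 ?(ltW a0) ?(ltW eta0).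
have -> : 6 * eta ^+ 2 / n%:R * (n%:R * Lbar L * (n%:R * (n%:R * sigma2_any g xs)))
    = 6 * ((n%:R * eta) ^+ 2 * Lbar L * sigma2_any g xs).
  by field; rewrite gt_eqF.
move: h2; lra.
Qed.

Lemma random_bound (P : {ffun 'I_K -> 'S_n} -> R)
    (X : {ffun 'I_K -> 'S_n} -> nat -> 'rV[R]_d) :
  uniform_marginals P ->
  (forall w : {ffun 'I_K -> 'S_n}, prox_shuffling_run g psi eta x1 w (X w)) ->
  (\sum_(w : {ffun 'I_K -> 'S_n}) (P w)%:E * (Fobj fs psi (X w K.+1) - Fobj fs psi xs) <=
    (72 * (enorm (xs - x1) ^+ 2 / (n%:R * eta * K%:R)
      + (n%:R * eta) ^+ 2 * Lbar L * (sigma2_rand g xs / n%:R) * lK))%:E)%E.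
Proof.
move=> unif runs; have [P0 [P1 _]] := unif.
have last w := run_last_gap (runs w).
under eq_bigr => w _.
  rewrite /Fobj -(fineK (last w).1) -(fineK xs_dom) -!EFinD -EFinM /=.
  over.
rewrite sumEFin lee_fin.
set A := dotv (xs - x1) (xs - x1) / (2 * eta * n%:R) / K%:R in last.
apply: (@le_trans _ _ (4 * (A + suffix_noise K (fun k => \sum_w P w * epoch_noise w k)))).
  have AE : A = \sum_w P w * A by rewrite -mulr_suml P1 mul1r.
  rewrite -suffix_noise_sum [in leRHS]AE -big_split mulr_sumr.
  apply: ler_sum => w _ /=; rewrite -mulrDr mulrCA.
  by apply: ler_wpM2l => //; exact: (last w).2.
have nn : 0 < n%:R :> R by rewrite ltr0n.
apply: noise_bound; last by rewrite divr_ge0 ?sigma2_rand_ge0.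
move=> k kK; rewrite /epoch_noise.
under eq_bigr do rewrite insubT mulrCA.
rewrite -mulr_sumr (uniform_marginals_mean _ _ unif).
have c0 : 0 <= 6 * eta ^+ 2 / n%:R by rewrite divr_ge0 // mulr_ge0 ?sqr_ge0.
apply: le_trans (ler_wpM2l c0 (mean_prefix_noise_le g xs n0 L0)) _.
have -> : dotv (\sum_i g i xs) (\sum_i g i xs) = n%:R ^+ 2 * enorm (gradf g xs) ^+ 2.
  by rewrite sqr_enorm dotvZl dotvZr; field; rewrite gt_eqF.
rewrite sum_sqr_grad /sigma2_rand.
(* Six times this is the slack: the mean noise carries 18 on [sigma2_any] but only 12 on the squared
   norm of the full gradient. *)
have h : 0 <= eta ^+ 2 * Lbar L * n%:R * (n%:R * enorm (gradf g xs) ^+ 2).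
  move: (Lbar L) (Lbar_gt0 n0 L0) => a a0.
  by rewrite !mulr_ge0 ?sqr_ge0 ?(ltW a0) ?(ltW eta0) ?enorm_ge0.
rewrite -subr_ge0; have {}h := mulr_ge0 (ler0n R 6) h.
by apply: le_trans h _; rewrite le_eqVlt; apply/predU1P; left; field; rewrite gt_eqF.
Qed.

End Run.

(** * Assembly of the four bounds with one absolute constant *)

Theorem theorem4p1 :
  exists C : nat, (0 < C)%N /\
  forall (R : realType) (n d : nat) (fs : 'I_n -> 'rV[R]_d -> R)
    (g : 'I_n -> 'rV[R]_d -> 'rV[R]_d) (L : 'I_n -> R)
    (psi : 'rV[R]_d -> \bar R) (xs x1 : 'rV[R]_d) (K : nat) (eta : R),
    (0 < n)%N ->
    (forall i, convex_fun (fs i)) ->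
    (forall i x, is_gradient (fs i) (g i x) x) ->
    (forall i, 0 < L i) ->
    (forall i x y, enorm (g i x - g i y) <= L i * enorm (x - y)) ->
    proper_fun psi -> closed_fun psi -> convex_efun psi ->
    psi xs \is a fin_num ->
    (forall x, (Fobj fs psi xs <= Fobj fs psi x)%E) ->
    psi x1 \is a fin_num ->
    (2 <= K)%N ->
    0 < eta ->
    eta <= (4 * n%:R * Num.sqrt (2 * Lbar L * Lstar L * (1 + ln K%:R)))^-1 ->
    let D := enorm (xs - x1) in
    let Lb := Lbar L in
    let Ls := Lstar L in
    let lK := 1 + ln K%:R in
    let sa := sigma2_any g xs in
    let sr := sigma2_rand g xs in
    let eta0 := (4 * n%:R * Num.sqrt (2 * Lb * Ls * lK))^-1 in
    (* (i) arbitrary permutations *)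
    ((forall (sigma : 'I_K -> 'S_n) (x : nat -> 'rV[R]_d),
        prox_shuffling_run g psi eta x1 sigma x ->
        (Fobj fs psi (x K.+1) - Fobj fs psi xs <=
          (C%:R * (D ^+ 2 / (n%:R * eta * K%:R)
                   + (n%:R * eta) ^+ 2 * Lb * sa * lK))%:E)%E)
     /\
     (0 < D -> 0 < sa ->
      eta = Num.min eta0
              (D `^ (2 / 3) / (n%:R * (Lb * sa * K%:R * lK) `^ (3^-1))) ->
      forall (sigma : 'I_K -> 'S_n) (x : nat -> 'rV[R]_d),
        prox_shuffling_run g psi eta x1 sigma x ->
        (Fobj fs psi (x K.+1) - Fobj fs psi xs <=
          (C%:R * (D ^+ 2 * Num.sqrt (Lb * Ls * lK) / K%:R
                   + D `^ (4 / 3) * (Lb * sa * lK) `^ (3^-1)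
                     / K%:R `^ (2 / 3)))%:E)%E))
    /\
    (* (ii) uniformly random permutations (arbitrary joint law across epochs) *)
    ((forall (P : {ffun 'I_K -> 'S_n} -> R)
        (X : {ffun 'I_K -> 'S_n} -> nat -> 'rV[R]_d),
        uniform_marginals P ->
        (forall w : {ffun 'I_K -> 'S_n}, prox_shuffling_run g psi eta x1 w (X w)) ->
        (\sum_(w : {ffun 'I_K -> 'S_n}) (P w)%:E * (Fobj fs psi (X w K.+1) - Fobj fs psi xs) <=
          (C%:R * (D ^+ 2 / (n%:R * eta * K%:R)
                   + n%:R * eta ^+ 2 * Lb * sr * lK))%:E)%E)
     /\
     (0 < D -> 0 < sr ->
      eta = Num.min eta0
              (D `^ (2 / 3) / (n%:R ^+ 2 * Lb * sr * K%:R * lK) `^ (3^-1)) ->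
      forall (P : {ffun 'I_K -> 'S_n} -> R)
        (X : {ffun 'I_K -> 'S_n} -> nat -> 'rV[R]_d),
        uniform_marginals P ->
        (forall w : {ffun 'I_K -> 'S_n}, prox_shuffling_run g psi eta x1 w (X w)) ->
        (\sum_(w : {ffun 'I_K -> 'S_n}) (P w)%:E * (Fobj fs psi (X w K.+1) - Fobj fs psi xs) <=
          (C%:R * (D ^+ 2 * Num.sqrt (Lb * Ls * lK) / K%:R
                   + D `^ (4 / 3) * (Lb * sr * lK) `^ (3^-1)
                     / (n%:R `^ (3^-1) * K%:R `^ (2 / 3))))%:E)%E)).
Proof.
(* The run bounds carry 72 and the stepsize tradeoff at most 6, so 432 would do. *)
exists 500%N; split => // R n d fs g L psi xs x1 K eta n0 cvx grad L0 lip proper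
  _ pcvx xs_dom xs_min x1_dom K2 eta0 eta_le D Lb Ls lK sa sr etamax.
have K0 : (0 < K)%N by exact: ltn_trans K2.
have nn : 0 < n%:R :> R by rewrite ltr0n.
have KK : 0 < K%:R :> R by rewrite ltr0n.
have Lb0 : 0 < Lb by exact: Lbar_gt0.
have Ls0 : 0 < Ls := lt_le_trans Lb0 (Lbar_le_Lstar L n0).
have lK0 : 0 < lK := lt_le_trans ltr01 (lK_ge1 R K0).
have D0 : 0 <= D := enorm_ge0 _.
have sa0 : 0 <= sa by exact: sigma2_any_ge0.
have sr0 : 0 <= sr by exact: sigma2_rand_ge0.
have any sigma x := @adversarial_bound _ _ _ _ _ _ _ _ _ _ _ n0 K0 eta0 cvx grad
  L0 lip proper pcvx xs_dom xs_min x1_dom eta_le sigma x.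
have rnd P X := @random_bound _ _ _ _ _ _ _ _ _ _ _ n0 K0 eta0 cvx grad
  L0 lip proper pcvx xs_dom xs_min x1_dom eta_le P X.
have first_le (s : R) : 0 <= s ->
    72 * (D ^+ 2 / (n%:R * eta * K%:R) + (n%:R * eta) ^+ 2 * Lb * s * lK) <=
    500%:R * (D ^+ 2 / (n%:R * eta * K%:R) + (n%:R * eta) ^+ 2 * Lb * s * lK).
  move=> s0; apply: ler_wpM2r; last by rewrite ler_nat.
  apply: addr_ge0; last first.
    by rewrite mulr_ge0 ?(ltW lK0) // mulr_ge0 // mulr_ge0 ?sqr_ge0 ?(ltW Lb0).
  by rewrite divr_ge0 ?sqr_ge0 // !mulr_ge0 ?(ltW eta0).
have second_le (s : R) : 0 < D -> 0 < s ->
    eta = Num.min etamax (D `^ (2 / 3) / (n%:R * (Lb * s * K%:R * lK) `^ (3^-1))) ->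
    72 * (D ^+ 2 / (n%:R * eta * K%:R) + (n%:R * eta) ^+ 2 * Lb * s * lK) <=
    500%:R * (D ^+ 2 * Num.sqrt (Lb * Ls * lK) / K%:R
              + D `^ (4 / 3) * (Lb * s * lK) `^ (3^-1) / K%:R `^ (2 / 3)).
  move=> Dpos s0 etaE.
  have := stepsize_tradeoff Dpos Lb0 Ls0 lK0 s0 nn KK etaE.
  have : 0 <= D ^+ 2 * Num.sqrt (Lb * Ls * lK) / K%:R.
    by rewrite divr_ge0 ?mulr_ge0 ?sqr_ge0 ?sqrtr_ge0.
  have : 0 <= D `^ (4 / 3) * (Lb * s * lK) `^ (3^-1) / K%:R `^ (2 / 3).
    by rewrite divr_ge0 ?mulr_ge0 ?powR_ge0.
  move: (_ / _) (_ / _) (_ / _ + _) => b a c; lra.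
split; split.
- move=> sigma x run; apply: le_trans (any sigma x run) _.
  by rewrite lee_fin; exact: first_le.
- move=> Dpos sapos etaE sigma x run; apply: le_trans (any sigma x run) _.
  by rewrite lee_fin; exact: second_le.
- move=> P X unif runs; apply: le_trans (rnd P X unif runs) _.
  rewrite lee_fin.
  (* The random case has the form of the adversarial one with variance [sr / n]. *)
  have -> : n%:R * eta ^+ 2 * Lb * sr * lK =
      (n%:R * eta) ^+ 2 * Lb * (sr / n%:R) * lK.
    by move: (lK) (Lb) (sr) => l b s; field; rewrite gt_eqF.
  by apply: first_le; rewrite divr_ge0.
- move=> Dpos srpos etaE P X unif runs; apply: le_trans (rnd P X unif runs) _.
  rewrite lee_fin.
  have spos : 0 < sr / n%:R by rewrite divr_gt0.
  (* Pulling [n] out of the cube root identifies the stepsize of the random case with the tradeoff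
     stepsize at variance [sr / n]. *)
  have rootE (z : R) : 0 <= z ->
      (n%:R ^+ 3 * z) `^ (3^-1) = n%:R * z `^ (3^-1).
    move=> z0; rewrite powRM ?exprn_ge0 // -powR_mulrn // -powRrM divff //.
    by rewrite powRr1.
  have -> : D `^ (4 / 3) * (Lb * sr * lK) `^ (3^-1) / (n%:R `^ (3^-1) * K%:R `^ (2 / 3))
      = D `^ (4 / 3) * (Lb * (sr / n%:R) * lK) `^ (3^-1) / K%:R `^ (2 / 3).
    have -> : Lb * sr * lK = n%:R * (Lb * (sr / n%:R) * lK).
      by move: (lK) (Lb) (sr) => l b s; field; rewrite gt_eqF.
    rewrite powRM ?ltW //; last by apply: mulr_gt0 => //; apply: mulr_gt0.
    by field; rewrite !gt_eqF ?powR_gt0.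
  apply: second_le => //; rewrite etaE -rootE; last first.
    by rewrite ltW //; do 2 (apply: mulr_gt0 => //); apply: mulr_gt0.
  congr (Num.min _ (_ / _ `^ _)).
  by rewrite -/sr; move: (lK) (Lb) (sr) => l b s; field; rewrite gt_eqF.
Qed.
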